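(* Let $n\ge 3$ be an integer. Let $d$ be the odd divisor of $(n-1)n$, different from $n-1$ and $n$, that minimizes $\left|d-\frac{(n-1)n}{d}\right|$, let $e=(n-1)n/d$, and let $$q=\frac{\max(d,e)-\min(d,e)-1}{2}.$$ Let $m$ be the nonnegative integer with $T_{n-1}+T_q=T_m$. Then $A(n)=q+m-n$.
   Context: $T_j=j(j+1)/2$ denotes the $j$-th triangular number. For an integer $n\ge 3$, $A(n)$ is the smallest positive integer $k$ such that $n+k+1$ divides $n+(n+1)+\cdots+(n+k)=(k+1)n+\frac{k(k+1)}{2}$ (such a $k$ exists for all $n\ge 3$). *)

(* Defs.v *)
From mathcomp Require Import all_boot all_algebra.
From mathcomp Require Import zify.

Set Implicit Arguments.
Unset Strict Implicit.
Unset Printing Implicit Defensive.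

Definition T (j : nat) : nat := j * (j + 1) %/ 2.

Definition divides_run (n k : nat) : bool :=
  n + k + 1 %| \sum_(n <= i < n + k + 1) i.

Lemma divides_run_exists (n : nat) :
  3 <= n -> exists k, (0 < k) && divides_run n k.
Proof.
move=> hn; exists (n * (n - 2) - 1); apply/andP; split; first by nia.
rewrite /divides_run; set k := n * (n - 2) - 1.
have sumE a b : 2 * (\sum_(a <= i < a + b + 1) i) = (b + 1) * (2 * a + b).
  rewrite addn1; elim: b => [|b IH]; first by rewrite addn0 big_nat1; lia.
  by rewrite big_nat_recr /=; [rewrite mulnDr addnS IH; nia | lia].
have kE : n + k + 1 = n * (n - 1) by rewrite /k; nia.
have [c cE] : exists c, (n - 2) * (n + 1) = 2 * c.
  exists (((n - 2) * (n + 1)) %/ 2); rewrite [RHS]mulnC divnK // dvdn2 oddM.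
  by rewrite oddB ?oddD /=; [case: (odd n) | lia].
apply/dvdnP; exists c; apply/eqP; rewrite -(eqn_pmul2l (isT : 0 < 2)) sumE kE.
rewrite mulnA -cE; apply/eqP.
have -> : k + 1 = n * (n - 2) by rewrite /k; nia.
have -> : 2 * n + k = (n - 1) * (n + 1) by rewrite /k; nia.
by nia.
Qed.

(* The proof argument is needed: for n = 2 there is no suitable k. *)
Definition A (n : nat) (hn : 3 <= n) : nat := ex_minn (divides_run_exists hn).

Arguments A n hn : clear implicits.

Definition admissible (n d : nat) : bool :=
  [&& odd d, d %| (n - 1) * n, d != n - 1 & d != n].

(* [`|a - b|%N] is the distance between a and b (the subtraction is taken in
   [int], so it is not truncated). *)
Definition gap (n d : nat) : nat := `|d - (n - 1) * n %/ d|%N.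

Definition minimizes_gap (n d : nat) : Prop :=
  admissible n d /\ (forall d', admissible n d' -> gap n d <= gap n d').

(* Main.v *)
Require Import Defs.
From mathcomp Require Import all_boot all_algebra.
From mathcomp Require Import zify.

(** Put [N = (n - 1) * n] and [s = n + k + 1].  Twice the sum of the run is
    [(s - n) * (s + n - 1) = s * (s - 1) - N], so [s] divides the sum exactly
    when [s] divides [N] and [s - 1 - N / s] is even, that is, when [s] and
    [N / s] are complementary divisors of [N] of opposite parity
    ([divides_runP]).  The condition [0 < k] says that [s > n + 1], which makes
    [s] the larger of the two divisors and rules out the pair [n - 1], [n];
    conversely, in any other pair of opposite parity the larger divisor exceeds
    [n + 1], because neither [n] nor [n + 1] can occur there
    ([admissible_cofactor], [admissible_of_run]).  Hence [A n + n + 1] is the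
    least possible larger member of such a pair.

    For pairs with a fixed product, the difference increases with the larger
    member ([leq_factor_gap]), so this least value is attained by the pair
    [d], [e] of minimal difference ([A_minimizes_gap]).  Finally
    [T m - T q = (m - q) * (m + q + 1) / 2] equals [T (n - 1) = N / 2] when
    [m - q] and [m + q + 1] are the smaller and the larger member of [d], [e];
    since [T] is injective this is the only [m], and
    [q + m = max d e - 1 = A n + n]. *)

(** * Triangular numbers and sums of runs *)

Lemma double_run_sum n k :
  2 * (\sum_(n <= i < n + k + 1) i) = (k + 1) * (2 * n + k).
Proof.
rewrite addn1; elim: k => [|k IH]; first by rewrite addn0 big_nat1; lia.
by rewrite big_nat_recr /=; [rewrite mulnDr addnS IH; nia | lia].
Qed.

Lemma double_T j : 2 * T j = j * (j + 1).
Proof.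
rewrite /T mulnC divnK // dvdn2 oddM oddD.
by case: (odd j).
Qed.

Lemma T_inj : injective T.
Proof. by move=> i j eqT; move: (double_T i) (double_T j); rewrite eqT; nia. Qed.

(** * Divisibility of a run as a factorization of opposite parity *)

Lemma muln_min_max a b : minn a b * maxn a b = a * b.
Proof. by have [_|_] := leqP a b; rewrite // mulnC. Qed.

(** The cofactor of [s = n + k + 1] in [(n - 1) * n] is [s - 1 - 2 * x], where
    [x] is the quotient of the sum of the run by [s]. *)
Lemma divides_runP n k : 0 < n ->
  reflect (exists2 c, c * (n + k + 1) = (n - 1) * n & odd c != odd (n + k + 1))
          (divides_run n k).
Proof.
move=> n_gt0; have sumE := double_run_sum n k.
set s := n + k + 1 in sumE *; rewrite /divides_run -/s.
have prodE : (k + 1) * (2 * n + k) + (n - 1) * n = s * (s - 1).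
  by rewrite /s; nia.
apply: (iffP dvdnP) => [[x xE]|[c cE par]].
  rewrite xE in sumE.
  have s_gt0 : 0 < s by rewrite /s addn1.
  have le_x : 2 * x <= s - 1.
    by rewrite -(leq_pmul2l s_gt0) -prodE -sumE mulnCA [s * x]mulnC leq_addr.
  exists (s - 1 - 2 * x).
    by rewrite mulnBl [(s - 1) * s]mulnC -prodE -sumE mulnA addKn.
  by rewrite /s in le_x *; lia.
have c_le : c <= s - 1.
  have : c <= n - 1; last by rewrite /s; lia.
  by rewrite -(leq_pmul2r n_gt0) -cE leq_mul2l /s -addnA leq_addr orbT.
exists ((s - 1 - c) %/ 2).
have halfE : 2 * ((s - 1 - c) %/ 2) = s - 1 - c.
  by rewrite mulnC divnK // dvdn2; rewrite /s in par c_le *; lia.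
apply/eqP; rewrite -(eqn_pmul2l (isT : 0 < 2)) sumE mulnA halfE.
by rewrite mulnBl cE [(s - 1) * s]mulnC -prodE addnK.
Qed.

(** The bound [n + 1 < maxn d e] is where the exclusion of [n - 1] and [n] is
    used: the larger factor is at least [n] by size, and it is not [n + 1]
    because [(n - 1) * n = (n + 1) * (n - 2) + 2] and [n + 1 > 2]. *)
Lemma admissible_cofactor n d : 3 <= n -> admissible n d ->
  exists e, [/\ (n - 1) * n %/ d = e, d * e = (n - 1) * n,
                odd d, ~~ odd e & n + 1 < maxn d e].
Proof.
move=> n_ge3 /and4P[d_odd d_dvd d_n1 d_n].
exists ((n - 1) * n %/ d); have := divnK d_dvd.
set e := _ %/ d => eE.
have e_even : ~~ odd e.
  have : odd (e * d) = false by rewrite eE oddM oddB; [case: (odd n) | lia].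
  by rewrite oddM d_odd andbT => ->.
split=> //; first by rewrite mulnC.
have ne_de : d != e by apply: contraNneq e_even => <-.
have big a b : a * b = (n - 1) * n -> a < b -> b != n -> n + 1 < b.
  move=> abE lt_ab b_n.
  have b_n1 : b != n + 1.
    apply/eqP => bE; rewrite bE in abE.
    (* [(n + 1) * (n - 2) < (n - 1) * n < (n + 1) * (n - 1)]. *)
    have : a <= n - 2 \/ n - 1 <= a by lia.
    by case; nia.
  have : b <= n - 1 \/ n < b by lia.
  by case; nia.
have [lt_de|le_ed] := ltnP d e.
  apply: (big d) => //; first by rewrite mulnC.
  by apply/eqP => eE'; move: d_n1; rewrite eE' in eE; nia.
by apply: (big e) => //; lia.
Qed.

(** The required odd divisor is whichever of [n + k + 1] and its cofactor is
    odd. *)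
Lemma admissible_of_run n k : 3 <= n -> 0 < k -> divides_run n k ->
  exists2 d, admissible n d & maxn d ((n - 1) * n %/ d) = n + k + 1.
Proof.
move=> n_ge3 k_gt0 /divides_runP[|c cE par]; first lia.
have c_lt : c < n - 1 by nia.
have c_gt0 : 0 < c by nia.
case c_odd : (odd c).
  exists c; last by rewrite -cE mulKn //; lia.
  by apply/and4P; split=> //; [rewrite -cE dvdn_mulr | lia | lia].
exists (n + k + 1); last by rewrite -cE mulnK; lia.
by apply/and4P; split; [lia | rewrite -cE dvdn_mull | lia | lia].
Qed.

(** * The pair of minimal difference *)

(** With the product fixed, a larger maximum forces a smaller minimum. *)
Lemma leq_factor_gap a b c d : 0 < a * b -> a * b = c * d ->
  (`|a - b|%N <= `|c - d|%N) = (maxn a b <= maxn c d).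
Proof.
wlog le_ab : a b / a <= b => [hw|].
  have [/hw //|/hw {}hw] := orP (leq_total a b).
  by rewrite (distnC a) (maxnC a) (mulnC a).
wlog le_cd : c d / c <= d => [hw|].
  have [/hw //|/hw {}hw] := orP (leq_total c d).
  by rewrite (distnC c) (maxnC c) (mulnC c).
move=> ab_gt0 abE; rewrite (maxn_idPr le_ab) (maxn_idPr le_cd).
have -> : (`|a - b|%N = b - a)%N by lia.
have -> : (`|c - d|%N = d - c)%N by lia.
by apply/idP/idP => ?; nia.
Qed.

(** Equal gaps give the same unordered pair of factors, and exactly one member
    of that pair is odd. *)
Lemma minimizes_gap_uniq n d d' : 3 <= n ->
  minimizes_gap n d -> minimizes_gap n d' -> d = d'.
Proof.
move=> n_ge3 [ad mind] [ad' mind'].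
have := mind _ ad'; have := mind' _ ad; rewrite /gap.
have [e [-> deE d_odd e_even _]] := admissible_cofactor _ _ n_ge3 ad.
have [e' [-> deE' d_odd' e_even' _]] := admissible_cofactor _ _ n_ge3 ad'.
have N_gt0 : 0 < (n - 1) * n by nia.
rewrite !leq_factor_gap ?deE ?deE' // => le1 le2.
have : maxn d e = maxn d' e' by lia.
have [_|_] := leqP d e; have [_|_] := leqP d' e' => E.
- have e_gt0 : 0 < e by move: N_gt0; rewrite -deE muln_gt0 => /andP[].
  by apply/eqP; rewrite -(eqn_pmul2r e_gt0) deE E deE'.
- by move: e_even; rewrite E d_odd'.
- by move: e_even'; rewrite -E d_odd.
- by [].
Qed.

Lemma minimizes_gap_exists n : 3 <= n -> exists d, minimizes_gap n d.
Proof.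
move=> n_ge3.
have ex_gap : exists g, has (fun d => admissible n d && (gap n d == g))
                            (iota 0 ((n - 1) * n).+1).
  (* [1] is admissible, since [1 < n - 1]. *)
  exists (gap n 1); apply/hasP; exists 1; first by rewrite mem_iota; nia.
  by rewrite eqxx andbT; apply/and4P; split=> //; lia.
case: (ex_minnP ex_gap) => g /hasP[d _ /andP[ad /eqP gE]] ming.
exists d; split=> // d' ad'; rewrite gE; apply: ming.
apply/hasP; exists d'; last by rewrite ad' eqxx.
case/and4P: ad' => _ /dvdn_leq d_le _ _.
by rewrite mem_iota /= add0n ltnS d_le //; nia.
Qed.

(** The larger member of the optimal pair yields a run, and the shortest run
    yields an admissible pair to compare with the optimal one. *)
Lemma A_minimizes_gap n (hn : 3 <= n) d : minimizes_gap n d ->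
  A n hn + n + 1 = maxn d ((n - 1) * n %/ d).
Proof.
move=> [ad mind]; rewrite /A.
case: ex_minnP => k /andP[k_gt0 run_k] mink; apply/eqP; rewrite eqn_leq.
apply/andP; split.
  have [e [-> deE d_odd e_even big]] := admissible_cofactor _ _ hn ad.
  have : k <= maxn d e - n - 1.
    apply: mink; apply/andP; split; first lia.
    apply/divides_runP; first lia.
    have -> : n + (maxn d e - n - 1) + 1 = maxn d e by lia.
    exists (minn d e); first by rewrite muln_min_max.
    by rewrite /maxn /minn; case: ltnP; rewrite d_odd (negbTE e_even).
  by lia.
have [d' ad' maxE] := admissible_of_run _ _ hn k_gt0 run_k.
have := mind _ ad'; rewrite /gap.
have [e [-> deE _ _ _]] := admissible_cofactor _ _ hn ad.
have [e' [e'E deE' _ _ _]] := admissible_cofactor _ _ hn ad'.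
by rewrite e'E in maxE *; rewrite leq_factor_gap ?deE ?deE' ?maxE //; [lia | nia].
Qed.

(** * The theorem *)

(** [T (a + q) - T q] is half of [a * (2 * q + a + 1)]. *)
Lemma T_add_factor n a b q : 0 < n -> a * b = (n - 1) * n ->
  2 * q + a + 1 = b -> T (n - 1) + T q = T (a + q).
Proof.
move=> n_gt0 abE bE; apply/eqP; rewrite -(eqn_pmul2l (isT : 0 < 2)) mulnDr.
by rewrite !double_T; apply/eqP; nia.
Qed.

(* The two [exists!] conjuncts express the definite descriptions "the odd
   divisor d" and "the nonnegative integer m".  The number
   maxn d e - minn d e - 1 is a nonnegative even integer, as d is odd and e is
   even, so neither the truncated subtraction nor the halving loses anything. *)
Theorem mainTheorem2 (n : nat) (hn : 3 <= n) :
  (exists! d : nat, minimizes_gap n d) /\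
  (forall d : nat, minimizes_gap n d ->
    let e := (n - 1) * n %/ d in
    let q := (maxn d e - minn d e - 1) %/ 2 in
    (exists! m : nat, T (n - 1) + T q = T m) /\
    (forall m : nat, T (n - 1) + T q = T m ->
      ((A n hn)%:Z = q%:Z + m%:Z - n%:Z)%R)).
Proof.
split.
  have [d mind] := minimizes_gap_exists n hn.
  by exists d; split=> // d'; exact: minimizes_gap_uniq.
move=> d mind; have := A_minimizes_gap n hn d mind.
have [e [-> deE d_odd e_even _]] := admissible_cofactor n d hn mind.1.
move=> AE /=; set q := _ %/ 2.
have qE : 2 * q + minn d e + 1 = maxn d e by rewrite /q; lia.
have mE : T (n - 1) + T q = T (minn d e + q).
  apply: (T_add_factor n (minn d e) (maxn d e)) => //; first lia.
  by rewrite muln_min_max.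
have m_uniq m : T (n - 1) + T q = T m -> m = minn d e + q.
  by rewrite mE => /T_inj.
split; first by exists (minn d e + q); split=> // m /m_uniq.
by move=> m /m_uniq ->; lia.
Qed.
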